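(* Let $n\geq 4$ and $\ell$ be integers with $2\leq \ell\leq n-1$. (1) For $\ell=n-1$, $e_3(n,n-1,3)=n-1$. (2) For $\ell=n-2$, $e_3(n,n-2,3)=2n-5$. (3) For $\ell=n-3$, $e_3(n,n-3,3)=2n-5$. (4) For $\ell=2$: $e_3(n,2,3)=3$ if $n=4$; $e_3(n,2,3)=5$ if $n=5$; $e_3(n,2,3)=\infty$ if $n\geq 6$. (5) For $\frac{n}{2}\leq \ell\leq n-4$, $n\leq e_3(n,\ell,3)\leq \ell(n-\ell)$.
   Context: All graphs are undirected, finite and simple. For a graph $G$ and a nonempty set $S\subseteq V(G)$, the Steiner distance $d_G(S)$ is the minimum number of edges of a connected subgraph (equivalently, a subtree) of $G$ whose vertex set contains $S$; set $d_G(S)=\infty$ if there is none. The Steiner $3$-diameter is $sdiam_3(G)=\max\{d_G(S): S\subseteq V(G),\ |S|=3\}$. For natural numbers $n,\ell,d$ with $d<n$, $\ell<n$, let $\mathscr{H}_3(n,\ell,d)$ be the set of all graphs $G$ of order $n$ with maximum degree exactly $\ell$ and $sdiam_3(G)\leq d$. Put $e_3(n,\ell,d)=\min\{|E(G)|: G\in \mathscr{H}_3(n,\ell,d)\}$, with $e_3(n,\ell,d)=\infty$ if $\mathscr{H}_3(n,\ell,d)=\emptyset$. *)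

(* Defs.v *)
From HB Require Import structures.
From mathcomp Require Import all_boot all_order all_algebra.
From mathcomp Require Export constructive_ereal.
Export Order.TTheory GRing.Theory Num.Theory.

Set Implicit Arguments.
Unset Strict Implicit.
Unset Printing Implicit Defensive.

(* A graph is a vertex set together with a set of unordered pairs of distinct
   vertices, inside an ambient finite type [T]; the vertex set need not be all
   of [T], so that a subgraph of a graph is again a graph over [T]. *)
Definition is_graph (T : finType) (g : {set T} * {set {set T}}) : bool :=
  [forall e in g.2, (#|e| == 2) && (e \subset g.1)].

Record graph (T : finType) := Graph {
  graph_val : {set T} * {set {set T}};
  graph_valP : is_graph graph_val }.

HB.instance Definition _ (T : finType) := [isSub for @graph_val T].
HB.instance Definition _ (T : finType) := [Finite of graph T by <:].

Section GraphNotions.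
Variable T : finType.
Implicit Types (G H : graph T) (S : {set T}).

Definition vertices G : {set T} := (graph_val G).1.
Definition edges G : {set {set T}} := (graph_val G).2.

Definition adjacent G : rel T := [rel x y | [set x; y] \in edges G].

Definition subgraph H G : bool :=
  (vertices H \subset vertices G) && (edges H \subset edges G).

Definition connected G : bool :=
  [forall x in vertices G, forall y in vertices G, connect (adjacent G) x y].

Definition degree G (x : T) : nat := #|[set e in edges G | x \in e]|.

Definition max_degree G : nat := \max_(x in vertices G) degree G x.

(* The values of the next three notions are extended natural numbers, seen in
   [\bar int]; a minimum over the empty family is [+oo]. *)
Definition steiner_dist G S : \bar int :=
  \big[mine/+oo%E]_(H : graph T | [&& subgraph H G, connected H
                                    & S \subset vertices H])
     ((#|edges H|)%:Z)%:E.

(* The bottom element [-oo] is returned only for graphs of order less than 3,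
   which have no set of three vertices. *)
Definition sdiam3 G : \bar int :=
  \big[maxe/-oo%E]_(S : {set T} | (S \subset vertices G) && (#|S| == 3))
     steiner_dist G S.

End GraphNotions.

(* Graphs of order [n] are taken with vertex set ['I_n]. *)
Definition H3 (n l d : nat) : {set graph 'I_n} :=
  [set G | [&& #|vertices G| == n, max_degree G == l
             & (sdiam3 G <= (d%:Z)%:E)%E]].

Definition e3 (n l d : nat) : \bar int :=
  \big[mine/+oo%E]_(G in H3 n l d) ((#|edges G|)%:Z)%:E.

(* Main.v *)
Require Import Defs.
From mathcomp Require Import all_boot all_order all_algebra zify.

(* Lower bounds.  Let [u] be a vertex not adjacent to [v].  If [w] and [x] lie
   outside the component of [u] in [G - v], a tree on at most four vertices
   containing [u], [w] and [x] has [v] as its fourth vertex, and then [u] has no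
   possible neighbour in it.  So that component misses at most one vertex of
   [G - v], which leaves at least [n - 3] edges besides those at [v].  If [v] has
   two non-neighbours and the component does miss a vertex, both of them are
   adjacent to the whole component, which therefore contains a cycle: one more
   edge.  In maximum degree 2, a tree on four vertices is a path, so there is no
   independent triple, and for [n >= 6] the non-neighbours of a vertex form a
   triangle cut off from the rest.

   Upper bounds.  The extremal graphs are stars, two or three hubs sharing the
   remaining vertices, and complete bipartite graphs. *)

Set Implicit Arguments.
Unset Strict Implicit.
Unset Printing Implicit Defensive.

(** * Connectivity through edge sets, degrees and edge counts *)

Lemma connect_first (T : finType) (e : rel T) (x y : T) :
  connect e x y -> x != y -> exists z, e x z.
Proof.
case/connectP=> [[|z p]] /=; first by move=> _ ->; rewrite eqxx.
by case/andP=> exz _ _ _; exists z.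
Qed.

Section EdgeSets.
Variable T : finType.
Implicit Types (F : {set {set T}}) (C : {set T}) (G : graph T).

Definition link F : rel T := [rel x y | [set x; y] \in F].

Lemma link_sym F : symmetric (link F).
Proof. by move=> x y; rewrite /link /= setUC. Qed.

Lemma connect_link_sym F : connect_sym (link F).
Proof. exact/sym_connect_sym/link_sym. Qed.

(** A maximal set [W] containing [r] and having at most one more vertex than edges of [F] inside it
    is closed under [link F], so it contains everything reachable from [r], in particular [C]. *)
Lemma connected_card_le F (r : T) C :
  {in C, forall y, connect (link F) r y} -> #|C| <= #|F|.+1.
Proof.
move=> rC; pose inside (W : {set T}) := [set e in F | e \subset W].
pose P (W : {set T}) := (r \in W) && (#|W| <= #|inside W|.+1).
have P1 : P [set r] by rewrite /P set11 cards1.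
have [W /maxsetP[/andP[rW leW] maxW] _] := maxset_exists P1.
have clW : closed (link F) (mem W).
  apply: intro_closed; first exact: connect_link_sym.
  move=> x y xy xW; apply/negPn/negP=> yW.
  have := maxW (y |: W); rewrite subsetU1 => /(_ _ isT) E.
  (* Adjoining [y] adds one vertex, and the edge [[set x; y]] becomes an inside edge, so [P]
     persists. *)
  suff /E Wy : P (y |: W) by move: yW; rewrite -Wy setU11.
  rewrite /P inE rW orbT cardsU1 yW add1n ltnS.
  apply: leq_trans leW _; apply: proper_card; apply/properP; split.
    apply/subsetP=> e; rewrite !inE => /andP[-> /subset_trans-> //].
    exact: subsetU1.
  exists [set x; y]; rewrite !inE; first by rewrite (xy : [set x; y] \in F) subUset !sub1set !inE xW eqxx orbT.
  by rewrite negb_and subUset !sub1set (negPf yW) andbF orbT.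
apply: leq_trans (_ : #|W| <= _).
  apply/subset_leq_card/subsetP=> y /rC ry.
  by rewrite -(closed_connect clW ry).
apply: leq_trans leW _; rewrite ltnS; apply/subset_leq_card/subsetP=> e.
by rewrite inE => /andP[].
Qed.

Lemma edgeP G e : e \in edges G -> #|e| = 2 /\ e \subset vertices G.
Proof.
move=> eG; have := graph_valP G; rewrite /is_graph => /'forall_implyP /(_ e).
by move=> /(_ eG) /andP[/eqP].
Qed.

Lemma adjacent_neq G x y : adjacent G x y -> x != y.
Proof.
by move=> /edgeP[]; rewrite cards2; case: eqP.
Qed.

Lemma adjacent_vertices G x y : adjacent G x y -> y \in vertices G.
Proof. by move=> /edgeP[_ /subsetP]; apply; rewrite set22. Qed.

Lemma adjacent_sym G : symmetric (adjacent G).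
Proof. exact: link_sym. Qed.

Lemma degreeE G x : degree G x = #|[set y | adjacent G x y]|.
Proof.
rewrite /degree -(card_in_imset (f := fun y => [set x; y])).
  apply/eq_card=> e; rewrite inE; apply/andP/imsetP.
    case=> eG xe; have [/eqP/cards2P[a [b [ab eab]]] _] := edgeP eG.
    subst e; move: xe; rewrite !inE => /orP[] /eqP xa; subst x.
      by exists b => //; rewrite inE.
    by exists a; [rewrite inE adjacent_sym | rewrite setUC].
  by case=> y; rewrite inE => xy ->; rewrite set21.
move=> y z; rewrite !inE => xy xz eyz.
have: y \in [set x; z] by rewrite -eyz set22.
by rewrite !inE eq_sym (negPf (adjacent_neq xy)) => /eqP.
Qed.

Lemma card_nonneighbors G x :
  #|~: (x |: [set y | adjacent G x y])| = #|T| - (degree G x).+1.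
Proof.
rewrite cardsCs setCK cardsU1 -degreeE in_set.
by case: (boolP (adjacent G x x)) => [/adjacent_neq|]; rewrite ?eqxx.
Qed.

Definition avoiding G (x : T) := [set e in edges G | x \notin e].

Lemma link_avoiding G v x y :
  link (avoiding G v) x y = [&& adjacent G x y, x != v & y != v].
Proof. by rewrite /link /= !inE negb_or ![v == _]eq_sym. Qed.

Lemma card_edges_avoiding G x : #|edges G| = degree G x + #|avoiding G x|.
Proof.
rewrite /degree -(cardsID [set e : {set T} | x \in e] (edges G)); congr (_ + _).
  by apply: eq_card => e; rewrite !inE.
by apply: eq_card => e; rewrite !inE andbC.
Qed.

(** The bound of three on edges becomes one of four on vertices because [H] is connected; with three
    vertices prescribed, a single one stays free. *)
Lemma sdiam3_tree G x y z : (sdiam3 G <= (3%N%:Z)%:E)%E ->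
  [set x; y; z] \subset vertices G -> x != y -> x != z -> y != z ->
  exists H : graph T, [/\ edges H \subset edges G, connected H,
    [set x; y; z] \subset vertices H & #|vertices H| <= 4].
Proof.
move=> /bigmax_leP[_ /(_ [set x; y; z])] + SG xy xz yz.
have c3 : #|[set x; y; z]| == 3 by rewrite setUC cardsU1 cards2 !inE xy negb_or ![z == _]eq_sym xz yz.
rewrite SG c3 => /(_ isT).
pose Q (H : graph T) := [&& subgraph H G, connected H & [set x; y; z] \subset vertices H].
have [/existsP[H /andP[]]|] := boolP [exists H, Q H && (#|edges H| <= 3)].
  case/and3P=> /andP[_ HE] Hc HS H3 _; exists H; split=> //.
  have xH : x \in vertices H by apply: (subsetP HS); rewrite !inE eqxx.
  apply: (leq_trans (connected_card_le (F := edges H) (r := x) _)) => //.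
  by move=> w wH; move: Hc => /'forall_implyP/(_ x xH)/'forall_implyP/(_ w wH).
(* If every candidate has more than three edges, so does the minimum, whose default [+oo] is also
   above 3. *)
move=> /existsPn noH; rewrite leNgt => /negP[].
apply: lt_bigmin => [|H QH]; first exact: ltry.
have := noH H; rewrite /Q QH /= -ltnNge lte_fin.
by rewrite ltz_nat.
Qed.

End EdgeSets.

(** Pigeonhole. It serves to name all vertices of a small tree, or all neighbours of a vertex of
    degree at most two. *)
Lemma mem_uniq_full (T : finType) (A : {set T}) (s : seq T) (y : T) :
  uniq s -> {subset s <= A} -> #|A| <= size s -> y \in A -> y \in s.
Proof.
move=> us sA As yA; apply: contraLR As => ys; rewrite -ltnNge cardE.
apply: (@uniq_leq_size _ (y :: s)) => /=; first by rewrite ys.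
by move=> z; rewrite inE mem_enum => /orP[/eqP->|/sA].
Qed.

Lemma exists_notin (T : finType) (s : seq T) :
  size s < #|T| -> exists x, x \notin s.
Proof.
move=> sT; apply/existsP; apply: contraTT sT => /existsPn allin.
rewrite -leqNgt; apply: leq_trans (card_size s); apply/subset_leq_card/subsetP=> x _.
by have := allin x; rewrite negbK.
Qed.

Lemma connectedP (T : finType) (G : graph T) (x y : T) :
  connected G -> x \in vertices G -> y \in vertices G ->
  connect (adjacent G) x y.
Proof. by move=> /'forall_implyP cG /cG /'forall_implyP; apply. Qed.

(** * Lower bounds from Steiner 3-diameter at most 3 *)

Section SmallSteinerDiameter.
Variables (T : finType) (G : graph T).
Hypotheses (VG : vertices G = setT) (dG : (sdiam3 G <= (3%N%:Z)%:E)%E).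

Let tree3 x y z : uniq [:: x; y; z] ->
  exists H : graph T, [/\ subrel (adjacent H) (adjacent G), connected H,
    {subset [:: x; y; z] <= vertices H} & #|vertices H| <= 4].
Proof.
rewrite /= !inE negb_or andbT => /andP[/andP[xy xz] yz].
have := sdiam3_tree dG _ xy xz yz; rewrite VG => /(_ (subsetT _)).
case=> H [HG cH SH cardH]; exists H; split=> //.
  by move=> a b /(subsetP HG).
by move=> a aS; apply: (subsetP SH); rewrite !inE -orbA in aS *.
Qed.

(* A tree on at most four vertices containing [u], [w], [x] must pass through
   [v], so [v] is the fourth vertex, and [x] is the only possible neighbour
   of [u] in the tree. *)
Lemma link_of_disconnected u v w x :
  ~~ adjacent G v u -> uniq [:: u; v; w; x] ->
  ~~ connect (link (avoiding G v)) u w -> link (avoiding G v) u x.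
Proof.
move=> nvu U nuw.
have U' : uniq [:: u; w; x].
  by move: U; rewrite /= !inE !negb_or => /and4P[/and3P[_ -> ->] _ -> _].
have [uv uw wv xv] : [/\ u != v, u != w, w != v & x != v].
  move: U; rewrite /= !inE !negb_or => /and4P[/and3P[? ? _] /andP[? ?] _ _].
  by split; rewrite // eq_sym.
have [H [HG cH SH cardH]] := tree3 U'.
have uH : u \in vertices H by apply: SH; rewrite inE eqxx.
have wH : w \in vertices H by apply: SH; rewrite !inE eqxx orbT.
have cuw := connectedP cH uH wH.
(* A tree that misses [v] would connect [u] to [w] inside [G - v]. *)
have [vH|vH] := boolP (v \in vertices H); last first.
  case/negP: nuw; apply: connect_sub cuw => a b ab; apply: connect1.
  rewrite link_avoiding HG //=; apply/andP; split; apply: contraNneq vH => <-.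
    by apply: (@adjacent_vertices _ _ b); rewrite adjacent_sym.
  exact: adjacent_vertices ab.
have [y uy] := connect_first cuw uw.
have : y \in [:: u; v; w; x].
  apply: (mem_uniq_full U _ cardH); last exact: adjacent_vertices uy.
  move=> a; rewrite inE => /orP[/eqP->//|]; rewrite inE => /orP[/eqP->//|].
  by move=> aS; apply: SH; rewrite inE aS orbT.
rewrite !inE eq_sym (negPf (adjacent_neq uy)) /=.
case/or3P=> /eqP ey; subst y.
- by case/negP: nvu; rewrite adjacent_sym HG.
- by case/negP: nuw; apply: connect1; rewrite link_avoiding HG // uv.
- by rewrite link_avoiding HG // uv.
Qed.

Lemma edges_ge_nonadjacent u v : u != v -> ~~ adjacent G v u ->
  degree G v + (#|T| - 3) <= #|edges G|.
Proof.
move=> uv nvu; rewrite (card_edges_avoiding G v) leq_add2l.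
(* [w] is the one vertex of [G - v] that [u] may fail to reach: once some [w] is missed, every other
   vertex is adjacent to [u]. *)
have [w Kw] : exists w, {in ~: [set v; w], forall y, connect (link (avoiding G v)) u y}.
  have [/existsP[w /andP[wv nuw]]|/existsPn con] :=
    boolP [exists w, (w != v) && ~~ connect (link (avoiding G v)) u w].
    exists w => y; rewrite !inE negb_or => /andP[yv yw].
    have [->|yu] := eqVneq y u; first exact: connect0.
    apply/connect1/(link_of_disconnected nvu _ nuw); rewrite /= !inE !negb_or uv.
    rewrite ![_ == y]eq_sym yv yu yw [v == w]eq_sym wv !andbT.
    by apply: contraNneq nuw => ->; apply: connect0.
  (* Nothing is missed; [v] stands in for [w], and [[set v; w]] only gets smaller. *)
  exists v => y; rewrite !inE orbb => yv.
  by have := con y; rewrite yv negbK.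
have := connected_card_le Kw; have := cardsC [set v; w].
rewrite cards2; lia.
Qed.

(** Either [G - v] is connected, or [u1], [u2] and a further vertex span a triangle, one of whose
    edges can be spared. Both cases gain one edge over the bound from a single non-neighbour. *)
Lemma edges_ge_two_nonadjacent u1 u2 v : uniq [:: u1; u2; v] ->
  ~~ adjacent G v u1 -> ~~ adjacent G v u2 -> 4 < #|T| ->
  degree G v + (#|T| - 2) <= #|edges G|.
Proof.
move=> U n1 n2 T5; rewrite (card_edges_avoiding G v) leq_add2l.
set F := avoiding G v.
have [u12 u1v u2v] : [/\ u1 != u2, u1 != v & u2 != v].
  by move: U; rewrite /= !inE negb_or => /and3P[/andP[-> ->] -> _].
have [/existsP[w /andP[wv nuw]]|/existsPn con] :=
    boolP [exists w, (w != v) && ~~ connect (link F) u1 w]; last first.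
  have Kv : {in ~: [set v], forall y, connect (link F) u1 y}.
    by move=> y; rewrite !inE => yv; have := con y; rewrite yv negbK.
  have := connected_card_le Kv; have := cardsC [set v]; rewrite cards1; lia.
have u1w : u1 != w by apply: contraNneq nuw => <-; apply: connect0.
have adj1 x : x \notin [:: u1; v; w] -> link F u1 x.
  rewrite !inE !negb_or => /and3P[xu xv xw].
  apply: (link_of_disconnected n1 _ nuw).
  by rewrite /= !inE !negb_or u1v u1w ![_ == x]eq_sym xu xv xw [v == w]eq_sym wv.
(* Were [w] equal to [u2], any vertex [x] besides [u1], [u2] and [v] would be adjacent to both [u1]
   and [u2], joining them in [G - v]. *)
have u2w : u2 != w.
  have [x] : exists x, x \notin [:: u1; u2; v] by apply/exists_notin/ltnW.
  rewrite !inE !negb_or => /and3P[x1 x2 xv].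
  apply/eqP => e2; subst w.
  have xlink1 : link F u1 x by apply: adj1; rewrite !inE !negb_or x1 xv.
  have xlink2 : link F u2 x.
    apply: (link_of_disconnected n2 (w := u1)); last by rewrite connect_link_sym.
    by rewrite /= !inE !negb_or u2v [u2 == _]eq_sym u12 ![_ == x]eq_sym x1 x2 xv
      [v == _]eq_sym u1v.
  case/negP: nuw; apply: connect_trans (connect1 xlink1) (connect1 _).
  by rewrite link_sym.
have nu2w : ~~ connect (link F) u2 w.
  apply: contra nuw; apply: connect_trans; apply/connect1/adj1.
  by rewrite !inE !negb_or eq_sym u12 u2v.
(* A fifth vertex exists because [4 < #|T|]; it closes a triangle with [u1] and [u2]. *)
have [x] : exists x, x \notin [:: u1; u2; v; w] by apply: exists_notin.
rewrite !inE !negb_or => /and4P[x1 x2 xv xw].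
have xlink2 : link F u2 x.
  apply: (link_of_disconnected n2 _ nu2w).
  by rewrite /= !inE !negb_or u2v u2w ![_ == x]eq_sym x2 xv xw [v == w]eq_sym wv.
(* All of [~: [set v; w]] is adjacent to [u1], so the edge [u2 x] is redundant
   for connectedness. *)
have Kv : {in ~: [set v; w], forall y,
    connect (link (F :\ [set u2; x])) u1 y}.
  move=> y; rewrite !inE negb_or => /andP[yv yw].
  have [->|yu] := eqVneq y u1; first exact: connect0.
  apply: connect1; rewrite /link /= in_setD1; apply/andP; split; last first.
    by apply: adj1; rewrite !inE !negb_or yu yv.
  apply/eqP => /setP/(_ u1); rewrite !inE eqxx (negPf u12).
  by rewrite [u1 == x]eq_sym (negPf x1).
have e2F : [set u2; x] \in F by [].
have cF : #|F| = (#|F :\ [set u2; x]|).+1 by rewrite (cardsD1 [set u2; x]) e2F.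
rewrite cF; apply: leq_trans (connected_card_le Kv).
by rewrite leq_subLR -(cardsC [set v; w]) leq_add2r cards2 ltnS leq_b1.
Qed.

(** No tree edge joins two of the three vertices, so each of them has the fourth vertex [c] of the
    tree as its neighbour. *)
Lemma no_independent_triple x y z : uniq [:: x; y; z] ->
  ~~ adjacent G x y -> ~~ adjacent G x z -> ~~ adjacent G y z ->
  exists c, 3 <= degree G c.
Proof.
move=> U nxy nxz nyz; have [H [HG cH SH cardH]] := tree3 U.
have [xH yH zH] : [/\ x \in vertices H, y \in vertices H & z \in vertices H].
  by split; apply: SH; rewrite !inE eqxx ?orbT.
have [xy xz yz] : [/\ x != y, x != z & y != z].
  by move: U; rewrite /= !inE negb_or => /and3P[/andP[]].
have [c xc] := connect_first (connectedP cH xH yH) xy.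
have nxc a : a \in [:: x; y; z] -> a != c.
  rewrite !inE; case/or3P=> /eqP->; first exact: adjacent_neq xc.
    by apply: contraNneq nxy => ->; apply: HG.
  by apply: contraNneq nxz => ->; apply: HG.
have all_c a b : a \in [:: x; y; z] -> adjacent H a b ->
    {in [:: x; y; z], forall b, ~~ adjacent G a b} -> adjacent G a c.
  move=> aS ab na.
  have : b \in c :: [:: x; y; z].
    apply: (mem_uniq_full (s := [:: c; x; y; z]) _ _ cardH); last exact: adjacent_vertices ab.
      by rewrite cons_uniq U andbT; apply/negP=> /nxc; rewrite eqxx.
    move=> d; rewrite inE => /orP[/eqP->|/SH//]; exact: adjacent_vertices xc.
  rewrite inE => /orP[/eqP<-|/na]; first exact: HG.
  by rewrite HG.
have irr a : ~~ adjacent G a a by apply/negP=> /adjacent_neq; rewrite eqxx.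
exists c; rewrite degreeE.
have [y' yy'] := connect_first (connectedP cH yH zH) yz.
have [z' zz'] : exists z', adjacent H z z'.
  by apply: connect_first (connectedP cH zH xH) _; rewrite eq_sym.
have yc : adjacent G y c.
  apply: all_c yy' _; rewrite ?inE ?eqxx ?orbT // => b.
  by rewrite !inE => /or3P[]/eqP->; rewrite // adjacent_sym.
have zc : adjacent G z c.
  apply: all_c zz' _; rewrite ?inE ?eqxx ?orbT // => b.
  by rewrite !inE => /or3P[]/eqP->; rewrite // adjacent_sym.
rewrite cardE; apply: (uniq_leq_size U) => a.
rewrite mem_enum !inE ![adjacent G c a]adjacent_sym.
by case/or3P=> /eqP->; rewrite // HG.
Qed.

Lemma degree_ge3 : 5 < #|T| -> exists c, 3 <= degree G c.
Proof.
move=> T6; apply/existsP; apply: contraT => /existsPn deg.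
have {}deg c : degree G c <= 2 by have := deg c; rewrite -ltnNge.
have indep x y z : uniq [:: x; y; z] ->
    [|| adjacent G x y, adjacent G x z | adjacent G y z].
  move=> U; apply: contraT; rewrite !negb_or => /and3P[nxy nxz nyz].
  have [c] := no_independent_triple U nxy nxz nyz.
  by rewrite leqNgt ltnS deg.
have [v _] : exists v : T, v \notin [::].
  by apply: exists_notin; apply: leq_trans T6.
have : 2 < #|~: (v |: [set y | adjacent G v y])|.
  by rewrite card_nonneighbors ltn_subRL (leq_ltn_trans _ T6) // addnC ltnS ltnS ltnS deg.
case/card_gt2P=> [y1 [y2 [y3 [[m1 m2 m3] [y12 y23 y31]]]]].
have nv y : y \in ~: (v |: [set y | adjacent G v y]) -> y != v /\ ~~ adjacent G v y.
  by rewrite in_setC in_setU1 in_set negb_or => /andP[].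
have [[[v1 n1] [v2 n2]] [v3 n3]] := (nv _ m1, nv _ m2, nv _ m3).
have adj_non a b : a != v -> ~~ adjacent G v a -> b != v ->
    ~~ adjacent G v b -> a != b -> adjacent G a b.
  move=> av na bv nb ab; have := indep v a b; rewrite (negPf na) (negPf nb) /=.
  by apply; rewrite !inE negb_or ![v == _]eq_sym av bv ab.
have a12 := adj_non _ _ v1 n1 v2 n2 y12.
have a23 := adj_non _ _ v2 n2 v3 n3 y23.
have a31 := adj_non _ _ v3 n3 v1 n1 y31.
(* Degree at most 2 leaves a triangle vertex no neighbour besides the other two. *)
have nbrs a b c d : adjacent G a b -> adjacent G c a -> b != c ->
    adjacent G a d -> d \in [:: b; c].
  move=> ab ca bc ad; apply: (mem_uniq_full (A := [set y | adjacent G a y])).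
  - by rewrite /= inE bc.
  - by move=> e; rewrite !inE => /orP[]/eqP->; rewrite // adjacent_sym.
  - by rewrite -degreeE.
  - by rewrite inE.
have clP : closed (adjacent G) [:: y1; y2; y3].
  apply: intro_closed; first exact: connect_link_sym.
  move=> a b ab; rewrite !inE => /or3P[] /eqP ea; subst a.
  - have := nbrs _ _ _ _ a12 a31 y23 ab; rewrite !inE => ->; exact: orbT.
  - by have := nbrs _ _ _ _ a23 a12 y31 ab; rewrite !inE orbC => /orP[]->; rewrite ?orbT.
  - by have := nbrs _ _ _ _ a31 a23 y12 ab; rewrite !inE orbA => ->.
(* A tree through [y1] and [v] would have to leave the closed triangle; [y2] only completes the
   triple. *)
have U : uniq [:: y1; y2; v] by rewrite /= !inE negb_or y12 v1 v2.
have [H [HG cH SH _]] := tree3 U.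
have /connect_sub cHG : subrel (adjacent H) (connect (adjacent G)).
  by move=> a b /HG; apply: connect1.
have /cHG/(closed_connect clP) : connect (adjacent H) y1 v.
  by apply: connectedP cH _ _; apply: SH; rewrite !inE eqxx ?orbT.
by rewrite !inE eqxx ![v == _]eq_sym (negPf v1) (negPf v2) (negPf v3).
Qed.

End SmallSteinerDiameter.

(** * Subtrees built vertex by vertex *)

Definition subtree (T : finType) (G : graph T) (W : {set T}) (k : nat) :=
  exists H : graph T, [/\ edges H \subset edges G, connected H,
    vertices H = W & #|edges H| <= k].

Section Subtrees.
Variables (T : finType) (G : graph T).
Implicit Types (W : {set T}).

Lemma subtree1 x : subtree G [set x] 0.
Proof.
have P : is_graph ([set x], set0 : {set {set T}}).
  by apply/'forall_implyP => e; rewrite inE.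
exists (Graph P); split; rewrite /edges /= ?sub0set ?cards0 //.
apply/'forall_implyP=> a; rewrite /vertices inE => /eqP->.
by apply/'forall_implyP=> b; rewrite inE => /eqP->; apply: connect0.
Qed.

(** The alternative [x == y] allows a star whose centre is one of its targets. As [k] need not be
    attained, a vertex already in [W] costs nothing. *)
Lemma subtree_add W k x y :
  x \in W -> (x == y) || adjacent G x y ->
  subtree G W k -> subtree G (y |: W) k.+1.
Proof.
move=> xW xy [H [HG cH VH kH]].
have [yW|yW] := boolP (y \in W).
  by exists H; rewrite (setUidPr _) ?sub1set //; split=> //; apply: leqW.
have {}xy : adjacent G x y.
  by case/orP: xy => // /eqP xy; rewrite -xy xW in yW.
have P : is_graph (y |: W, [set x; y] |: edges H).
  apply/'forall_implyP => e /setU1P[->|eH].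
    by rewrite cards2 (adjacent_neq xy) subUset !sub1set !inE xW eqxx orbT.
  have [-> eW] := edgeP eH; rewrite eqxx /=.
  by apply: subset_trans eW _; rewrite VH subsetU1.
exists (Graph P); split; rewrite /edges //=.
- by rewrite subUset sub1set HG andbT.
- have xa a : a \in y |: W -> connect (adjacent (Graph P)) x a.
    case/setU1P=> [->|aW].
      by apply: connect1; rewrite /adjacent /edges /= setU11.
    have : connect (adjacent H) x a by apply: connectedP; rewrite ?VH.
    apply: connect_sub => b c bc; apply: connect1.
    by rewrite /adjacent /edges /= setU1r.
  apply/'forall_implyP=> a aV; apply/'forall_implyP=> b bV.
  apply: connect_trans (xa b bV).
  by rewrite (connect_link_sym (edges (Graph P))); apply: xa.
- by rewrite cardsU1; apply: leq_trans (leq_add (leq_b1 _) kH) _.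
Qed.

Lemma subtree_star c x y z :
  (c == x) || adjacent G c x -> (c == y) || adjacent G c y ->
  (c == z) || adjacent G c z -> subtree G [set z; y; x; c] 3.
Proof.
move=> cx cy cz; rewrite -!setUA.
apply: (subtree_add (x := c)) => //; first by rewrite !inE eqxx !orbT.
apply: (subtree_add (x := c)) => //; first by rewrite !inE eqxx !orbT.
apply: (subtree_add (x := c)) => //; first by rewrite !inE eqxx.
exact: subtree1.
Qed.

Lemma subtree_path a b c d :
  adjacent G a b -> adjacent G b c -> adjacent G c d ->
  subtree G [set d; c; b; a] 3.
Proof.
move=> ab bc cd; rewrite -!setUA.
apply: (subtree_add (x := c)); rewrite ?cd ?orbT ?inE ?eqxx //.
apply: (subtree_add (x := b)); rewrite ?bc ?orbT ?inE ?eqxx //.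
apply: (subtree_add (x := a)); rewrite ?ab ?orbT ?inE ?eqxx //.
exact: subtree1.
Qed.

End Subtrees.

(** Listing a triple in increasing order spares the constructions below the permutations of their
    cases. *)
Lemma sorted_triple n (S : {set 'I_n}) : #|S| = 3 ->
  exists x y z : 'I_n, [/\ x < y, y < z & S \subset [set x; y; z]].
Proof.
move=> S3; have /card_gt2P[x [y [z [[xS yS zS] [xy yz zx]]]]] : 2 < #|S|.
  by rewrite S3.
have sub a b c : a \in S -> b \in S -> c \in S -> a < b -> b < c ->
    S \subset [set a; b; c].
  move=> aS bS cS ab bc; apply/subsetP=> d dS; rewrite !inE -orbA.
  have := mem_uniq_full (s := [:: a; b; c]) _ _ _ dS; rewrite !inE; apply.
  - by rewrite /= !inE negb_or -!val_eqE /=; lia.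
  - by move=> e; rewrite !inE => /or3P[] /eqP->.
  - by rewrite S3.
move: xy yz zx; rewrite -!val_eqE /=.
case: (ltngtP x y) => // xy _; case: (ltngtP y z) => // yz _;
  case: (ltngtP z x) => // zx _; first [lia|
   by exists x, y, z; split=> //; apply: sub
 | by exists x, z, y; split=> //; apply: sub
 | by exists y, x, z; split=> //; apply: sub
 | by exists y, z, x; split=> //; apply: sub
 | by exists z, x, y; split=> //; apply: sub
 | by exists z, y, x; split=> //; apply: sub].
Qed.

Lemma sdiam3_le3 n (G : graph 'I_n) : vertices G = setT ->
  (forall x y z : 'I_n, x < y -> y < z ->
     exists W, subtree G W 3 /\ [set x; y; z] \subset W) ->
  (sdiam3 G <= (3%N%:Z)%:E)%E.
Proof.
move=> VG tree; apply/bigmax_leP; split=> [|S]; first exact: leNye.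
rewrite VG subsetT => /eqP /sorted_triple[x [y [z [xy yz Sxyz]]]].
have [W [[H [HG cH VH H3]] WS]] := tree x y z xy yz.
apply: (bigmin_inf H); last by rewrite lee_fin lez_nat.
rewrite /subgraph VG subsetT HG cH VH /=.
exact: subset_trans WS.
Qed.

(** * Graphs on labels given by an oriented relation *)

Section GraphOfRelation.
Variables (n : nat) (o : rel nat).

(* The orientation towards larger labels lets one count each edge once. *)
Definition symo : rel nat := [rel x y | (x < y) && o x y || (y < x) && o y x].

Lemma symo_neq x y : symo x y -> x != y.
Proof. by rewrite /symo /=; case: ltngtP. Qed.

Definition ograph_val : {set 'I_n} * {set {set 'I_n}} :=
  (setT, [set [set p.1; p.2] | p in [set p : 'I_n * 'I_n | symo p.1 p.2]]).

Lemma ograph_valP : is_graph ograph_val.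
Proof.
apply/'forall_implyP=> e /imsetP[[x y]] /=; rewrite inE /= => xy ->.
by rewrite subsetT cards2 andbT -val_eqE (symo_neq xy).
Qed.

Definition ograph : graph 'I_n := Graph ograph_valP.

Lemma adjacent_ograph x y : adjacent ograph x y = symo x y.
Proof.
apply/imsetP/idP => [[[a b]]|xy]; last by exists (x, y); rewrite ?inE.
rewrite inE /= => ab exy.
have nab : a != b by rewrite -val_eqE (symo_neq ab).
have : x \in [set a; b] by rewrite -exy set21.
have : y \in [set a; b] by rewrite -exy set22.
have : a \in [set x; y] by rewrite exy set21.
have : b \in [set x; y] by rewrite exy set22.
rewrite !inE => /orP[]/eqP eb /orP[]/eqP ea; subst; rewrite ?eqxx // in nab *.
by move=> _ _; rewrite /symo /= orbC.
Qed.

Lemma ograph_star (c x y z : 'I_n) :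
  (c == x :> nat) || symo c x -> (c == y :> nat) || symo c y ->
  (c == z :> nat) || symo c z ->
  exists W, subtree ograph W 3 /\ [set x; y; z] \subset W.
Proof.
move=> cx cy cz; exists [set z; y; x; c]; split.
  by apply: subtree_star; rewrite adjacent_ograph.
by rewrite !subUset !sub1set !inE !eqxx !orbT.
Qed.

Lemma ograph_path (a b c d : 'I_n) (S : {set 'I_n}) :
  symo a b -> symo b c -> symo c d -> S \subset [set d; c; b; a] ->
  exists W, subtree ograph W 3 /\ S \subset W.
Proof.
move=> ab bc cd SW; exists [set d; c; b; a]; split=> //.
by apply: subtree_path; rewrite adjacent_ograph.
Qed.

Lemma card_ord_le (A : {set 'I_n}) (s : seq nat) :
  (forall x, x \in A -> val x \in s) -> #|A| <= size s.
Proof.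
move=> As; rewrite cardE -(size_map val); apply: uniq_leq_size.
  by rewrite map_inj_uniq ?enum_uniq //; apply: val_inj.
by move=> k /mapP[x]; rewrite mem_enum => /As xs ->.
Qed.

Lemma card_edges_ograph (s : seq (nat * nat)) :
  (forall x y, x < y -> y < n -> o x y -> (x, y) \in s) ->
  #|edges ograph| <= size s.
Proof.
(* [f] takes pairs of plain numbers; a pair out of range yields a harmless extra set, as only an
   upper bound is sought. *)
move=> os; pose f (p : nat * nat) := [set z : 'I_n | (val z == p.1) || (val z == p.2)].
rewrite -(size_map f); apply: leq_trans (card_size _).
apply/subset_leq_card/subsetP=> e /imsetP[[x y]]; rewrite inE /= => xy ->.
apply/mapP; case/orP: xy => /andP[ltxy oxy].
  exists (val x, val y); first by apply: os; rewrite ?ltn_ord.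
  by apply/setP=> z; rewrite !inE /= !val_eqE.
exists (val y, val x); first by apply: os; rewrite ?ltn_ord.
by apply/setP=> z; rewrite !inE /= !val_eqE orbC.
Qed.

(** Vertex 0 attains the maximum degree through the last [l] labels, while the lists [s] cap all
    degrees from above. *)
Lemma ograph_in_H3 l :
  0 < n -> l < n ->
  (forall y, n - l <= y < n -> symo 0 y) ->
  (forall x, x < n ->
     exists2 s, size s <= l & forall y, y < n -> symo x y -> y \in s) ->
  (forall x y z : 'I_n, x < y -> y < z ->
     exists W, subtree ograph W 3 /\ [set x; y; z] \subset W) ->
  ograph \in H3 n l 3.
Proof.
move=> n0 ln nbr0 nbrs trees; rewrite inE; apply/and3P; split.
- by rewrite cardsT card_ord.
- rewrite eqn_leq; apply/andP; split.
    apply/bigmax_leqP=> x _; rewrite degreeE; have [s sl xs] := nbrs x (ltn_ord x).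
    apply: leq_trans (card_ord_le _) sl => y; rewrite inE adjacent_ograph.
    exact: xs.
  apply: (bigmax_sup (Ordinal n0)); first by rewrite inE.
  rewrite degreeE; set A := [set y | _].
  have cA : #|~: A| <= n - l.
    rewrite -(size_iota 0 (n - l)); apply: card_ord_le => y.
    rewrite !inE adjacent_ograph mem_iota /= add0n ltnNge; apply: contra => ly.
    by apply: nbr0; rewrite ly ltn_ord.
  have := cardsC A; rewrite card_ord => E.
  rewrite -(leq_add2r #|~: A|) E.
  by apply: leq_trans (_ : l + (n - l) <= n); rewrite ?leq_add2l ?subnKC // ltnW.
- exact: sdiam3_le3.
Qed.

End GraphOfRelation.

Lemma ord_lt_nat n k : k < n -> {x : 'I_n | x = k :> nat}.
Proof. by move=> kn; exists (Ordinal kn). Qed.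

Lemma e3_le n l (G : graph 'I_n) m :
  G \in H3 n l 3 -> #|edges G| <= m -> (e3 n l 3 <= (m%:Z)%:E)%E.
Proof.
by move=> GH Gm; apply: (bigmin_inf G) => //; rewrite lee_fin lez_nat.
Qed.

Lemma e3_ge n l m : (forall G, G \in H3 n l 3 -> m <= #|edges G|) ->
  ((m%:Z)%:E <= e3 n l 3)%E.
Proof.
move=> Gm; apply: le_bigmin => [|G /Gm]; first exact: leey.
by rewrite lee_fin lez_nat.
Qed.

(** * Explicit graphs and upper bounds *)

Ltac inside := by rewrite !subUset !sub1set !inE !eqxx ?orbT.

Definition star_rel : rel nat := [rel x y | x == 0].

Lemma e3_star n : 4 <= n -> (e3 n (n - 1) 3 <= ((n - 1)%N%:Z)%:E)%E.
Proof.
move=> n4; apply: (e3_le (G := ograph n star_rel)).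
  apply: ograph_in_H3; rewrite /symo /star_rel /=; try lia.
  - move=> x xn; case: (posnP x) => x0.
      exists (iota 1 (n - 1)); first by rewrite size_iota.
      by move=> y yn; rewrite mem_iota; lia.
    by exists [:: 0] => [|y yn]; rewrite ?inE /=; lia.
  - move=> x y z xy yz; have [c c0] : {c : 'I_n | c = 0 :> nat}.
      by apply: ord_lt_nat; lia.
    by apply: (ograph_star (c := c)); rewrite /symo /star_rel /= c0; lia.
have := card_edges_ograph (n := n) (o := star_rel)
  (s := [seq (0, y) | y <- iota 1 (n - 1)]).
rewrite size_map size_iota; apply=> x y xy yn /= /eqP x0; subst x.
by apply: map_f; rewrite mem_iota; lia.
Qed.

(* Vertex 2 is the pendant neighbour of 0. *)
Definition two_hub_rel : rel nat :=
  [rel x y | (x == 0) && (2 <= y) || (x == 1) && (3 <= y)].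

(** Hub 1 and the pendant vertex 2 are at distance 3, so a triple containing both takes a path;
    every other triple fits in a star. The edges number [(n - 2) + (n - 3)]. *)
Lemma e3_two_hub n : 4 <= n -> (e3 n (n - 2) 3 <= ((2 * n - 5)%N%:Z)%:E)%E.
Proof.
move=> n4; apply: (e3_le (G := ograph n two_hub_rel)).
  apply: ograph_in_H3; rewrite /symo /two_hub_rel /=; try lia.
  - move=> x xn; case: (ltnP x 2) => x2.
      exists (iota 2 (n - 2)); first by rewrite size_iota.
      by move=> y yn; rewrite mem_iota; lia.
    by exists [:: 0; 1] => [|y yn]; rewrite ?inE /=; lia.
  - move=> x y z xy yz.
    have [c0 c0E] : {c : 'I_n | c = 0 :> nat} by apply: ord_lt_nat; lia.
    have [c3 c3E] : {c : 'I_n | c = 3 :> nat} by apply: ord_lt_nat; lia.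
    have := ltn_ord z => zn.
    have [x0|x0] := ltnP x 1; [have [y1|y1] := ltnP y 2|have [x1|x1] := ltnP x 2].
    + have [z2|z2] := ltnP z 3.
        by apply: (ograph_path (a := z) (b := x) (c := c3) (d := y));
          [rewrite /symo /two_hub_rel /= ?c3E; lia .. | inside].
      by apply: (ograph_star (c := z)); rewrite /symo /two_hub_rel /=; lia.
    + by apply: (ograph_star (c := x)); rewrite /symo /two_hub_rel /=; lia.
    + have [y2|y2] := ltnP y 3.
        by apply: (ograph_path (a := x) (b := z) (c := c0) (d := y));
          [rewrite /symo /two_hub_rel /= ?c0E; lia .. | inside].
      by apply: (ograph_star (c := x)); rewrite /symo /two_hub_rel /=; lia.
    + by apply: (ograph_star (c := c0)); rewrite /symo /two_hub_rel /= c0E; lia.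
have := card_edges_ograph (n := n) (o := two_hub_rel)
  (s := [seq (0, y) | y <- iota 2 (n - 2)] ++ [seq (1, y) | y <- iota 3 (n - 3)]).
rewrite size_cat !size_map !size_iota => H; apply: leq_trans (H _) _; last by lia.
move=> x y xy yn /orP[] /andP[/eqP x0 y2]; subst x; rewrite mem_cat map_f ?orbT //.
  by rewrite mem_iota; lia.
by rewrite mem_iota; lia.
Qed.

(* The adjacent hubs 1 and 2 share out the neighbours of 0: vertex 3 goes to 1,
   all others to 2. *)
Definition three_hub_rel : rel nat :=
  [rel x y | [|| (x == 0) && (3 <= y), (x == 1) && (2 <= y <= 3)
               | (x == 2) && (4 <= y)]].

(** The graph is the 5-cycle 0, 3, 1, 2, 4 with vertex 4 replaced by [n - 4] pairwise non-adjacent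
    copies. A triple with at most one copy lies on a 5-cycle, hence on a path of four vertices; one
    with more copies fits in a star around 0 or 2. *)
Lemma e3_three_hub n : 5 <= n -> (e3 n (n - 3) 3 <= ((2 * n - 5)%N%:Z)%:E)%E.
Proof.
move=> n5; apply: (e3_le (G := ograph n three_hub_rel)).
  apply: ograph_in_H3; rewrite /symo /three_hub_rel /=; try lia.
  - move=> x xn; case: (posnP x) => x0.
      exists (iota 3 (n - 3)); first by rewrite size_iota.
      by move=> y yn; rewrite mem_iota; lia.
    have [x2|x2] := eqVneq x 2.
      exists (1 :: iota 4 (n - 4)); first by rewrite /= size_iota; lia.
      by move=> y yn; rewrite inE mem_iota; lia.
    have [x1|x1] := eqVneq x 1.
      by exists [:: 2; 3] => [|y yn]; rewrite ?inE /=; lia.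
    have [x3|x3] := eqVneq x 3.
      by exists [:: 0; 1] => [|y yn]; rewrite ?inE /=; lia.
    by exists [:: 0; 2] => [|y yn]; rewrite ?inE /=; lia.
  - move=> x y z xy yz.
    have [c0 c0E] : {c : 'I_n | c = 0 :> nat} by apply: ord_lt_nat; lia.
    have [c2 c2E] : {c : 'I_n | c = 2 :> nat} by apply: ord_lt_nat; lia.
    have [c3 c3E] : {c : 'I_n | c = 3 :> nat} by apply: ord_lt_nat; lia.
    have [c4 c4E] : {c : 'I_n | c = 4 :> nat} by apply: ord_lt_nat; lia.
    have := ltn_ord z => zn.
    have [x3|x3] := leqP 3 x.
      by apply: (ograph_star (c := c0)); rewrite /symo /three_hub_rel /= c0E; lia.
    have [x0|x0] := eqVneq (x : nat) 0.
      have [y3|y3] := leqP 3 y.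
        by apply: (ograph_star (c := x)); rewrite /symo /three_hub_rel /=; lia.
      have [y1|y1] := eqVneq (y : nat) 1.
        have [z2|z2] := eqVneq (z : nat) 2.
          by apply: (ograph_path (a := y) (b := z) (c := c4) (d := x));
            [rewrite /symo /three_hub_rel /= ?c4E; lia .. | inside].
        have [z3|z3] := eqVneq (z : nat) 3.
          by apply: (ograph_star (c := z)); rewrite /symo /three_hub_rel /=; lia.
        by apply: (ograph_path (a := x) (b := z) (c := c2) (d := y));
          [rewrite /symo /three_hub_rel /= ?c2E; lia .. | inside].
      have [z3|z3] := eqVneq (z : nat) 3.
        have [c1 c1E] : {c : 'I_n | c = 1 :> nat} by apply: ord_lt_nat; lia.
        by apply: (ograph_path (a := y) (b := c1) (c := z) (d := x));
          [rewrite /symo /three_hub_rel /= ?c1E; lia .. | inside].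
      by apply: (ograph_star (c := z)); rewrite /symo /three_hub_rel /=; lia.
    have [x1|x1] := eqVneq (x : nat) 1.
      have [y2|y2] := eqVneq (y : nat) 2.
        have [z3|z3] := eqVneq (z : nat) 3.
          by apply: (ograph_star (c := x)); rewrite /symo /three_hub_rel /=; lia.
        by apply: (ograph_star (c := y)); rewrite /symo /three_hub_rel /=; lia.
      have [y3|y3] := eqVneq (y : nat) 3.
        by apply: (ograph_path (a := x) (b := y) (c := c0) (d := z));
          [rewrite /symo /three_hub_rel /= ?c0E; lia .. | inside].
      by apply: (ograph_star (c := c2)); rewrite /symo /three_hub_rel /= c2E; lia.
    have [y3|y3] := eqVneq (y : nat) 3.
      by apply: (ograph_path (a := x) (b := z) (c := c0) (d := y));
        [rewrite /symo /three_hub_rel /= ?c0E; lia .. | inside].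
    by apply: (ograph_star (c := x)); rewrite /symo /three_hub_rel /=; lia.
have := card_edges_ograph (n := n) (o := three_hub_rel)
  (s := [seq (0, y) | y <- iota 3 (n - 3)] ++ [:: (1, 2); (1, 3)]
          ++ [seq (2, y) | y <- iota 4 (n - 4)]).
rewrite !size_cat !size_map !size_iota => H; apply: leq_trans (H _) _; last by rewrite /=; lia.
move=> x y xy yn /or3P[] /andP[/eqP x0 y2]; subst x; rewrite !mem_cat.
- by rewrite map_f // mem_iota; lia.
- have y23 : y = 2 \/ y = 3 by lia.
  by apply/or3P/Or32; case: y23 => ->.
- by apply/or3P/Or33/map_f; rewrite mem_iota; lia.
Qed.

Definition bipartite_rel (a : nat) : rel nat := [rel x y | x < a <= y].

Lemma e3_bipartite n l : 2 <= l <= n - 1 -> n <= 2 * l ->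
  (e3 n l 3 <= ((l * (n - l))%N%:Z)%:E)%E.
Proof.
move=> hl nl; apply: (e3_le (G := ograph n (bipartite_rel (n - l)))).
  apply: ograph_in_H3; rewrite /symo /bipartite_rel /=; try lia.
  - move=> x xn; have [x0|x0] := ltnP x (n - l).
      exists (iota (n - l) l); first by rewrite size_iota.
      by move=> y yn; rewrite mem_iota; lia.
    (* Here [n <= 2 * l] keeps the degree [n - l] of the second part within [l]. *)
    exists (iota 0 (n - l)); first by rewrite size_iota; lia.
    by move=> y yn; rewrite mem_iota; lia.
  - move=> x y z xy yz.
    (* Labels [n.-1] and 0 lie in different parts; each is the centre of the star for a triple
       inside the opposite part. A mixed triple is a star around its vertex that is alone in its
       part. *)
    have [c cE] : {c : 'I_n | c = n.-1 :> nat} by apply: ord_lt_nat; lia.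
    have [c0 c0E] : {c : 'I_n | c = 0 :> nat} by apply: ord_lt_nat; lia.
    have := ltn_ord z => zn.
    have [x0|x0] := leqP (n - l) x.
      by apply: (ograph_star (c := c0)); rewrite /symo /bipartite_rel /= c0E; lia.
    have [y0|y0] := leqP (n - l) y.
      by apply: (ograph_star (c := x)); rewrite /symo /bipartite_rel /=; lia.
    have [z0|z0] := leqP (n - l) z.
      by apply: (ograph_star (c := z)); rewrite /symo /bipartite_rel /=; lia.
    by apply: (ograph_star (c := c)); rewrite /symo /bipartite_rel /= cE; lia.
have := card_edges_ograph (n := n) (o := bipartite_rel (n - l))
  (s := [seq (x, y) | x <- iota 0 (n - l), y <- iota (n - l) l]).
rewrite size_allpairs !size_iota mulnC; apply=> x y xy yn /andP[xa ya].
by apply: allpairs_f; rewrite mem_iota; lia.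
Qed.

(** * Lower bounds for [e3] and combination of all bounds *)

Lemma H3_props n l (G : graph 'I_n) : 0 < n -> G \in H3 n l 3 ->
  [/\ vertices G = setT, (sdiam3 G <= (3%N%:Z)%:E)%E,
      exists v, degree G v = l & forall v, degree G v <= l].
Proof.
move=> n0; rewrite inE => /and3P[/eqP cV /eqP <- dG].
have VG : vertices G = setT.
  by apply/eqP; rewrite eqEcard subsetT cardsT card_ord cV leqnn.
split=> // [|v]; last by apply: leq_bigmax_cond; rewrite VG inE.
rewrite /max_degree.
have [|v _ ->] := eq_bigmax_cond (A := mem (vertices G)) (degree G).
  by rewrite cV.
by exists v.
Qed.

Lemma edges_ge_max_degree n l (G : graph 'I_n) : 1 < n -> l <= n - 2 ->
  G \in H3 n l 3 -> l + (n - 3) <= #|edges G|.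
Proof.
move=> n1 ln /(H3_props (ltnW n1))[VG dG [v vl] _].
have [u] : exists u, u \notin v |: [set y | adjacent G v y].
  have : 0 < #|~: (v |: [set y | adjacent G v y])|.
    by rewrite card_nonneighbors card_ord vl; lia.
  by case/card_gt0P=> u; rewrite inE => nu; exists u.
rewrite in_setU1 negb_or => /andP[uv]; rewrite in_set => nvu.
by have := edges_ge_nonadjacent VG dG uv nvu; rewrite vl card_ord.
Qed.

(** The general bound gives only [2 * n - 6] here; a vertex of degree [n - 3] has two
    non-neighbours, which yields the missing edge. *)
Lemma edges_ge_max_degree_sub3 n (G : graph 'I_n) : 5 <= n ->
  G \in H3 n (n - 3) 3 -> 2 * n - 5 <= #|edges G|.
Proof.
move=> n5; have n0 : 0 < n by lia.
move=> /(H3_props n0)[VG dG [v vl] _].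
have : 1 < #|~: (v |: [set y | adjacent G v y])|.
  by rewrite card_nonneighbors card_ord vl; lia.
case/card_gt1P=> u1 [u2 [m1 m2 u12]].
have nv u : u \in ~: (v |: [set y | adjacent G v y]) ->
    u != v /\ ~~ adjacent G v u.
  by rewrite in_setC in_setU1 in_set negb_or => /andP[].
have [[u1v n1] [u2v n2]] := (nv _ m1, nv _ m2).
have U : uniq [:: u1; u2; v] by rewrite /= !inE negb_or u12 u1v u2v.
have := edges_ge_two_nonadjacent VG dG U n1 n2.
rewrite card_ord vl => /(_ n5); lia.
Qed.

Theorem theorem3p2 (n l : nat) (hn : 4 <= n) (hl : 2 <= l <= n - 1) :
  [/\ l = n - 1 -> e3 n l 3 = ((n - 1)%N%:Z)%:E,
      l = n - 2 -> e3 n l 3 = ((2 * n - 5)%N%:Z)%:E,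
      l = n - 3 -> e3 n l 3 = ((2 * n - 5)%N%:Z)%:E,
      l = 2 ->
        [/\ n = 4 -> e3 n l 3 = (3%N%:Z)%:E,
            n = 5 -> e3 n l 3 = (5%N%:Z)%:E
          & 6 <= n -> e3 n l 3 = +oo%E]
    & n <= 2 * l -> l <= n - 4 ->
        ((n%:Z)%:E <= e3 n l 3)%E /\ (e3 n l 3 <= ((l * (n - l))%N%:Z)%:E)%E].
Proof.
have [n0 n1] : 0 < n /\ 1 < n by lia.
have part2 : l = n - 2 -> e3 n l 3 = ((2 * n - 5)%N%:Z)%:E.
  move=> ->; apply/le_anti/andP; split; first exact: e3_two_hub.
  apply: e3_ge => G GH; apply: leq_trans (edges_ge_max_degree n1 _ GH); lia.
have part3 : l = n - 3 -> e3 n l 3 = ((2 * n - 5)%N%:Z)%:E.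
  (* [2 <= l] excludes [n = 4]. *)
  move=> l3; have n5 : 5 <= n by lia.
  rewrite l3; apply/le_anti/andP; split; first exact: e3_three_hub.
  by apply: e3_ge => G; apply: edges_ge_max_degree_sub3.
split=> //.
- move=> ->; apply/le_anti/andP; split; first exact: e3_star.
  (* The edges at a vertex of degree [n - 1] already give the lower bound. *)
  apply: e3_ge => G /(H3_props n0)[_ _ [v <-] _].
  by rewrite (card_edges_avoiding G v) leq_addr.
(* Order 4 is the case [l = n - 2] and order 5 the case [l = n - 3]; from order 6 on the family is
   empty and the minimum takes its default [+oo]. *)
- move=> l2; split=> [n4|n5|n6].
  + by rewrite part2 ?n4 // l2 n4.
  + by rewrite part3 ?n5 // l2 n5.
  + have H0 : H3 n l 3 = set0.
      apply/setP=> G; rewrite [RHS]inE; apply/negP => /(H3_props n0)[VG dG _ deg].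
      have [|c] := degree_ge3 VG dG; first by rewrite card_ord.
      by rewrite leqNgt ltnS; apply/negP; rewrite negbK -l2.
    by rewrite /e3 H0 big_set0.
- move=> nl ln; split; last exact: e3_bipartite.
  (* [n <= 2 * l] and [l <= n - 4] force [4 <= l], so [l + (n - 3)] is at least [n]. *)
  apply: e3_ge => G GH; apply: leq_trans (edges_ge_max_degree n1 _ GH); lia.
Qed.
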